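(* For all integers $n\geq 1$ and $k\geq 0$, the higher-order tangent numbers satisfy $$\mathscr{T}(n,k)= (-1)^{\frac{n-k}{2}}\,(-1)^n\,\frac{2^n}{k!}\sum_{\alpha=k}^{n}\sum_{\beta=1}^{\alpha}(-1)^{\beta}\binom{\alpha-1}{k-1}\binom{\alpha}{\beta}\frac{\beta^n}{2^{\alpha}}.$$
   Context: For non-negative integers $n,k$, the higher-order tangent numbers $\mathscr{T}(n,k)$ are defined by the power series expansion $\frac{\tan^{k}t}{k!} = \sum_{n=k}^{\infty}\mathscr{T}(n,k)\frac{t^n}{n!}$, with $\mathscr{T}(n,k)=0$ for $n<k$. Empty sums are zero. Conventions: $\binom{m}{-1}=0$ for integers $m\ge0$ (when $k=0$ and $\alpha=0$ the inner sum is empty, so that term is zero), and $(-1)^{\frac{n-k}{2}}$ is read as the complex number $i^{\,n-k}$ (an ordinary sign when $n-k$ is even). *)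

(* Defs.v *)
From Stdlib Require Import Reals Lra Lia ZArith.
From Coquelicot Require Import Coquelicot.
Open Scope R_scope.

(* [T n k] is the coefficient of [t ^ n / n!] in the expansion of
   [tan t ^ k / k!] at 0.  The indices [n < k] contribute nothing, so the
   series written from [n = 0] is the one starting at [n = k]. *)
Definition higher_tangent_numbers (T : nat -> nat -> R) : Prop :=
  (forall n k : nat, (n < k)%nat -> T n k = 0) /\
  (forall k : nat,
     locally 0 (fun t : R =>
       is_pseries (fun n => T n k / INR (fact n)) t
                  (tan t ^ k / INR (fact k)))).

(* [binom m j] vanishes outside [0 <= j <= m], in particular at [j = -1];
   [Binomial.C] does not vanish for [j > m]. *)
Definition binom (m : nat) (j : Z) : R :=
  if andb (0 <=? j)%Z (j <=? Z.of_nat m)%Z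
  then Binomial.C m (Z.to_nat j) else 0.

Definition Cpowz (z : C) (m : Z) : C :=
  match m with
  | Z0 => RtoC 1
  | Zpos p => Cpow z (Pos.to_nat p)
  | Zneg p => Cinv (Cpow z (Pos.to_nat p))
  end.

(* Existence and uniqueness of the higher-order tangent numbers.  The
   coefficients of tan are built from y' = 1 + y ^ 2, y(0) = 0: [tan_approx m]
   has the right coefficients up to index [m]. *)
Fixpoint tan_approx (m j : nat) : R :=
  match m, j with
  | S m', S n =>
      ((if Nat.eqb n 0 then 1 else 0)
       + PS_mult (tan_approx m') (tan_approx m') n) / INR (S n)
  | _, _ => 0
  end.

Definition tan_coef (n : nat) : R := tan_approx n n.

Lemma tan_approx_stable (m j : nat) :
  (j <= m)%nat -> tan_approx m j = tan_coef j.
Proof.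
revert m; induction j as [j IH] using (well_founded_induction lt_wf).
intros m Hm; destruct j as [|n].
- now destruct m.
- destruct m as [|m]; [lia|].
  unfold tan_coef; simpl tan_approx; do 2 f_equal.
  unfold PS_mult; apply sum_eq; intros i Hi.
  rewrite (IH i), (IH (n - i)%nat) by lia.
  now rewrite !(fun q H1 H2 => IH q H1 n H2) by lia.
Qed.

Lemma tan_coef_S (n : nat) :
  tan_coef (S n) =
  ((if Nat.eqb n 0 then 1 else 0) + PS_mult tan_coef tan_coef n) / INR (S n).
Proof.
unfold tan_coef at 1; simpl tan_approx; do 2 f_equal.
unfold PS_mult; apply sum_eq; intros i Hi.
now rewrite !tan_approx_stable by lia.
Qed.

Lemma tan_coef_bound (n : nat) : Rabs (tan_coef n) <= 1.
Proof.
induction n as [n IH] using (well_founded_induction lt_wf).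
destruct n as [|n]; [unfold tan_coef; simpl; rewrite Rabs_R0; lra|].
rewrite tan_coef_S; unfold Rdiv; rewrite Rabs_mult, Rabs_inv.
assert (Hp : 0 < INR (S n)) by (apply lt_0_INR; lia).
rewrite (Rabs_pos_eq (INR (S n))) by lra.
apply Rmult_le_reg_r with (INR (S n)); [easy|].
rewrite Rmult_assoc, Rinv_l, Rmult_1_r, Rmult_1_l by lra.
destruct n as [|n].
- unfold PS_mult, tan_coef; simpl.
  rewrite Rmult_0_l, Rplus_0_r, Rabs_R1; lra.
- simpl Nat.eqb; cbv iota; rewrite Rplus_0_l; unfold PS_mult.
  eapply Rle_trans; [apply Rsum_abs|].
  eapply Rle_trans; [apply sum_Rle with (Bn := fun _ => 1)|].
  + intros i Hi; rewrite Rabs_mult.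
    assert (H1 := IH i ltac:(lia)).
    assert (H2 := IH (S n - i)%nat ltac:(lia)).
    assert (H3 := Rabs_pos (tan_coef i)).
    assert (H4 := Rabs_pos (tan_coef (S n - i)%nat)).
    nra.
  + rewrite sum_cte; lra.
Qed.

Lemma tan_coef_radius (x : R) :
  Rabs x < 1 -> Rbar_lt (Rabs x) (CV_radius tan_coef).
Proof.
intros Hx.
apply Rbar_lt_le_trans with (Finite 1); [easy|].
apply (proj1 (CV_radius_bounded tan_coef)); exists 1; intros n.
rewrite pow1, Rmult_1_r; apply tan_coef_bound.
Qed.

Lemma is_pseries_delta (x : R) :
  is_pseries (fun n => if Nat.eqb n 0 then 1 else 0) x 1.
Proof.
apply is_pseries_R.
apply (is_lim_seq_ext (fun _ => 1)
  (sum_n (fun n => (if Nat.eqb n 0 then 1 else 0) * x ^ n)) 1).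
- intros n; rewrite sum_n_Reals; induction n as [|n IH]; simpl; [ring|].
  rewrite <- IH; ring.
- apply is_lim_seq_const.
Qed.

Lemma tan_coef_derive (x : R) :
  Rabs x < 1 -> is_derive (PSeries tan_coef) x (1 + PSeries tan_coef x ^ 2).
Proof.
intros Hx; assert (Hr := tan_coef_radius x Hx).
replace (1 + PSeries tan_coef x ^ 2) with (PSeries (PS_derive tan_coef) x).
- now apply is_derive_PSeries.
- apply is_pseries_unique.
  assert (H1 := is_pseries_delta x).
  assert (H2 : is_pseries tan_coef x (PSeries tan_coef x))
    by now apply PSeries_correct, CV_radius_inside.
  assert (H3 := is_pseries_mult _ _ _ _ _ H2 H2 Hr Hr).
  simpl; rewrite Rmult_1_r.
  refine (is_pseries_ext _ _ _ _ _ (is_pseries_plus _ _ _ _ _ H1 H3)).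
  intros n; change (((if Nat.eqb n 0 then 1 else 0) + PS_mult tan_coef tan_coef n)
                  = INR (S n) * tan_coef (S n)).
  rewrite tan_coef_S; field; apply not_0_INR; lia.
Qed.

Lemma PSeries_tan_coef (x : R) : Rabs x < 1 -> PSeries tan_coef x = tan x.
Proof.
intros Hx.
assert (Hat : atan (PSeries tan_coef x) = x).
{ set (g := fun t => atan (PSeries tan_coef t) - t).
  assert (Hg : forall t, Rabs t < 1 -> is_derive g t 0).
  { intros t Ht; unfold g.
    assert (Hd := is_derive_comp atan (PSeries tan_coef) t _ _
                    (is_derive_atan _) (tan_coef_derive t Ht)).
    assert (He := is_derive_minus _ _ _ _ _ Hd (is_derive_id t)).
    replace 0 with (minus (scal (1 + PSeries tan_coef t ^ 2)
                   (/ (1 + (PSeries tan_coef t)²))) (one : R)); [exact He|].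
    unfold minus, plus, opp, scal, one, Rsqr; simpl; unfold mult; simpl.
    field; nra. }
  assert (H0 : g 0 = 0).
  { unfold g; rewrite PSeries_0; unfold tan_coef; simpl; rewrite atan_0; ring. }
  destruct (MVT_gen g 0 x (fun _ => 0)) as [c [_ Hc]].
  - intros t Ht; apply Hg.
    unfold Rmin, Rmax in Ht; destruct (Rle_dec 0 x);
      apply Rabs_def1; apply Rabs_def2 in Hx; lra.
  - intros t Ht; apply continuity_pt_filterlim.
    apply (ex_derive_continuous (V := R_NormedModule) g t).
    exists 0; apply Hg.
    unfold Rmin, Rmax in Ht; destruct (Rle_dec 0 x);
      apply Rabs_def1; apply Rabs_def2 in Hx; lra.
  - rewrite H0 in Hc; unfold g in Hc; lra. }
rewrite <- Hat at 2; now rewrite tan_atan.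
Qed.

Fixpoint tan_pow_coef (k : nat) : nat -> R :=
  match k with
  | O => fun n => if Nat.eqb n 0 then 1 else 0
  | S k' => PS_mult tan_coef (tan_pow_coef k')
  end.

Lemma tan_pow_coef_lt (k n : nat) : (n < k)%nat -> tan_pow_coef k n = 0.
Proof.
revert n; induction k as [|k IH]; intros n Hn; [lia|].
simpl; unfold PS_mult.
rewrite (sum_eq _ (fun _ => 0)); [rewrite sum_cte; ring|].
intros [|i] Hi.
- unfold tan_coef; simpl; ring.
- rewrite IH by lia; ring.
Qed.

Lemma tan_pow_coef_spec (k : nat) :
  Rbar_le 1 (CV_radius (tan_pow_coef k)) /\
  (forall x, Rabs x < 1 -> is_pseries (tan_pow_coef k) x (tan x ^ k)).
Proof.
assert (Hrad : forall a : nat -> R,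
  (forall x, Rabs x < 1 -> ex_pseries a x) -> Rbar_le 1 (CV_radius a)).
{ intros a Ha; apply Rbar_not_lt_le; intros Hlt.
  assert (Hge := CV_radius_ge_0 a).
  destruct (CV_radius a) as [r| |] eqn:E; try easy; simpl in Hlt, Hge.
  assert (Hm : Rabs ((r + 1) / 2) < 1) by (rewrite Rabs_pos_eq; lra).
  apply (CV_disk_outside a ((r + 1) / 2)).
  - rewrite E; simpl; rewrite Rabs_pos_eq; lra.
  - destruct (Ha _ Hm) as [l Hl].
    apply (ex_series_lim_0 (fun n => a n * ((r + 1) / 2) ^ n)).
    exists l; apply is_pseries_R; exact Hl. }
induction k as [|k [IHr IHs]].
- assert (H : forall x, Rabs x < 1 -> is_pseries (tan_pow_coef 0) x (tan x ^ 0)).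
  { intros x _; exact (is_pseries_delta x). }
  split; [apply Hrad; intros x Hx; eexists; apply H, Hx|exact H].
- assert (H : forall x, Rabs x < 1 ->
            is_pseries (tan_pow_coef (S k)) x (tan x ^ S k)).
  { intros x Hx; simpl; apply is_pseries_mult.
    - rewrite <- PSeries_tan_coef by easy.
      apply PSeries_correct, CV_radius_inside, tan_coef_radius, Hx.
    - now apply IHs.
    - now apply tan_coef_radius.
    - now apply Rbar_lt_le_trans with (Finite 1). }
  split; [apply Hrad; intros x Hx; eexists; apply H, Hx|exact H].
Qed.

Lemma higher_tangent_numbers_exist :
  exists T : nat -> nat -> R, higher_tangent_numbers T.
Proof.
exists (fun n k => INR (fact n) / INR (fact k) * tan_pow_coef k n); split.
- intros n k Hn; rewrite tan_pow_coef_lt by easy; ring.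
- intros k; exists (mkposreal 1 Rlt_0_1); intros t Ht.
  assert (Ht' : Rabs t < 1).
  { change (Rabs (t - 0) < 1) in Ht; now rewrite Rminus_0_r in Ht. }
  destruct (tan_pow_coef_spec k) as [_ Hs]; specialize (Hs t Ht').
  apply (is_pseries_scal (/ INR (fact k))) in Hs;
    [|unfold mult; simpl; ring].
  replace (tan t ^ k / INR (fact k)) with (scal (/ INR (fact k)) (tan t ^ k))
    by (unfold scal; simpl; unfold mult; simpl; unfold Rdiv; ring).
  refine (is_pseries_ext _ _ _ _ _ Hs); intros n.
  unfold PS_scal, scal; simpl; unfold mult; simpl.
  field; split; apply INR_fact_neq_0.
Qed.

Lemma higher_tangent_numbers_unique (T U : nat -> nat -> R) :
  higher_tangent_numbers T -> higher_tangent_numbers U ->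
  forall n k, T n k = U n k.
Proof.
assert (Hrad : forall V, higher_tangent_numbers V -> forall k,
  Rbar_lt 0 (CV_radius (fun n => V n k / INR (fact n)))).
{ intros V [_ HV] k; destruct (HV k) as [[e He] H].
  apply Rbar_lt_le_trans with (Finite (e / 2)); [simpl; lra|].
  apply Rbar_not_lt_le; intros Hlt.
  apply (CV_disk_outside (fun n => V n k / INR (fact n)) (e / 2)).
  - rewrite Rabs_pos_eq by lra; exact Hlt.
  - apply (ex_series_lim_0
      (fun n => (V n k / INR (fact n)) * (e / 2) ^ n)).
    eexists; apply is_pseries_R, H.
    change (Rabs (e / 2 - 0) < e); rewrite Rabs_pos_eq; lra. }
intros HT HU n k.
assert (E : T n k / INR (fact n) = U n k / INR (fact n)).
{ apply (PSeries_ext_recip (fun n => T n k / INR (fact n))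
                           (fun n => U n k / INR (fact n)));
    [now apply Hrad..|].
  generalize (filter_and _ _ (proj2 HT k) (proj2 HU k)).
  apply filter_imp; intros t [H1 H2].
  now rewrite (is_pseries_unique _ _ _ H1), (is_pseries_unique _ _ _ H2). }
apply Rmult_eq_reg_r with (/ INR (fact n)); [exact E|].
apply Rinv_neq_0_compat, INR_fact_neq_0.
Qed.

(* Main.v *)
Require Import Defs.
From Stdlib Require Import Reals ZArith Lra Lia.
From Coquelicot Require Import Coquelicot.
Open Scope R_scope.

(** The formula comes from writing [tan t = i u / (2 - u)] with
    [u = 1 - exp (2 i t)].  Then [tan t ^ k] is [i ^ k] times
    [(x / (1 - x)) ^ k] at [x = u / 2]; the coefficient of [x ^ alpha] in the
    latter is [binom (alpha - 1) (k - 1)], and the [n]-th derivative at 0 of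
    [u ^ alpha], expanded by the binomial theorem, is [(2 i) ^ n] times
    [altpow n alpha], the sum over [beta] of
    [(-1) ^ beta * binom alpha beta * beta ^ n].

    The proof below replaces this substitution of complex power series by the
    differential equation behind it.  Since [tan' = 1 + tan ^ 2], the numbers
    [A n k = k! * T n k] satisfy
    [A (n + 1) k = k * (A n (k - 1) + A n (k + 1))]  ([tangent_rec]).
    On the other side, let
    [S n k] be the sum over [alpha <= n] of
    [geom_coef alpha k * 2 ^ n / 2 ^ alpha * altpow n alpha].  The recurrence
    [altpow_rec] and summation by parts move the step from [n] to [n + 1] onto
    the coefficients [geom_coef], where it becomes the identity
    [geom_coef_rec], the coefficient form of the differential equation of
    [(x / (1 - x)) ^ k].  This yields
    [S (n + 1) k = k * (S n (k + 1) - S n (k - 1))]  ([tansum_rec]).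
    The factor [i ^ (n - k) * (-1) ^ n] turns the second recurrence into the
    first, so induction on [n] identifies the two sides as complex numbers.  No
    parity discussion is needed: for [n - k] odd, the two recurrences agree as
    well, and both sides are zero as a consequence. *)

(** * Recurrence of the higher-order tangent numbers *)

Lemma CV_radius_pos (a : nat -> R) :
  locally 0 (fun t : R => ex_pseries a t) -> Rbar_lt 0 (CV_radius a).
Proof.
intros [[e He] H].
apply Rbar_lt_le_trans with (Finite (e / 2)); [simpl; lra|].
apply Rbar_not_lt_le; intros Hlt.
apply (CV_disk_outside a (e / 2)).
- now rewrite Rabs_pos_eq by lra.
- apply (ex_series_lim_0 (fun n => a n * (e / 2) ^ n)).
  destruct (H (e / 2)) as [l Hl].
  + change (Rabs (e / 2 - 0) < e); rewrite Rabs_pos_eq; lra.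
  + exists l; now apply is_pseries_R.
Qed.

Lemma locally_in_disk (a : nat -> R) :
  Rbar_lt 0 (CV_radius a) ->
  locally 0 (fun t : R => Rbar_lt (Rabs t) (CV_radius a)).
Proof.
intros Ha.
assert (He : exists e : posreal, Rbar_le e (CV_radius a)).
{ destruct (CV_radius a) as [r| |]; simpl in Ha; [|now exists (mkposreal 1 Rlt_0_1)|easy].
  exists (mkposreal r Ha); apply Rle_refl. }
destruct He as [e He]; exists e; intros t Ht.
change (Rabs (t - 0) < e) in Ht; rewrite Rminus_0_r in Ht.
now apply Rbar_lt_le_trans with (Finite e).
Qed.

Lemma is_pseries_coef_unique (a b : nat -> R) (f : R -> R) (n : nat) :
  locally 0 (fun t : R => is_pseries a t (f t)) ->
  locally 0 (fun t : R => is_pseries b t (f t)) -> a n = b n.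
Proof.
intros Ha Hb; apply PSeries_ext_recip.
- apply CV_radius_pos; revert Ha; apply filter_imp; intros t Ht; now exists (f t).
- apply CV_radius_pos; revert Hb; apply filter_imp; intros t Ht; now exists (f t).
- generalize (filter_and _ _ Ha Hb); apply filter_imp; intros t [H1 H2].
  now rewrite (is_pseries_unique _ _ _ H1), (is_pseries_unique _ _ _ H2).
Qed.

Lemma is_pseries_is_derive (a : nat -> R) (f g : R -> R) :
  locally 0 (fun t : R => is_pseries a t (f t)) ->
  locally 0 (fun t : R => is_derive f t (g t)) ->
  locally 0 (fun t : R => is_pseries (PS_derive a) t (g t)).
Proof.
intros Ha Hf.
assert (Hr : Rbar_lt 0 (CV_radius a)).
{ apply CV_radius_pos; revert Ha; apply filter_imp; intros t Ht; now exists (f t). }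
generalize (filter_and _ _ (locally_in_disk a Hr)
             (filter_and _ _ (locally_locally _ _ Ha) Hf)).
apply filter_imp; intros t [Ht [Hl Hd]].
replace (g t) with (Derive (PSeries a) t); [now apply is_pseries_derive|].
apply is_derive_unique, (is_derive_ext_loc f); [|exact Hd].
revert Hl; apply filter_imp; intros s Hs; symmetry.
now apply is_pseries_unique.
Qed.

Lemma is_derive_tan_pow (k : nat) (t : R) :
  Rabs t < 1 ->
  is_derive (fun t => tan t ^ k) t
    (INR k * tan t ^ pred k + INR k * tan t ^ S k).
Proof.
intros Ht; assert (Hp := PI2_1); apply Rabs_def2 in Ht.
assert (Hc : cos t <> 0) by (apply Rgt_not_eq, cos_gt_0; lra).
assert (H := is_derive_pow tan k t _ (is_derive_tan t Hc)).
replace (INR k * tan t ^ pred k + INR k * tan t ^ S k)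
  with (INR k * (tan t ^ 2 + 1) * tan t ^ pred k); [exact H|].
destruct k as [|k]; [simpl; ring|]; simpl pred; simpl pow; ring.
Qed.

(** This is [D (tan ^ k) = k * (tan ^ (k - 1) + tan ^ (k + 1))] read on
    coefficients; the factor [INR k] makes the value of [pred 0] irrelevant. *)
Lemma tangent_rec (T : nat -> nat -> R) (n k : nat) :
  higher_tangent_numbers T ->
  INR (fact k) * T (S n) k =
  INR k * (INR (fact (pred k)) * T n (pred k) + INR (fact (S k)) * T n (S k)).
Proof.
intros [_ HT].
set (a := fun k n => INR (fact k) * T n k / INR (fact n)).
assert (Ha : forall k, locally 0 (fun t : R => is_pseries (a k) t (tan t ^ k))).
{ intros j; generalize (HT j); apply filter_imp; intros t Ht.
  apply (is_pseries_scal (INR (fact j))) in Ht; [|apply Rmult_comm].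
  replace (tan t ^ j)
    with (scal (INR (fact j)) (tan t ^ j / INR (fact j)) : R).
  - refine (is_pseries_ext _ _ _ _ _ Ht); intros m.
    unfold a, PS_scal, scal; simpl; unfold mult; simpl.
    unfold Rdiv; ring.
  - unfold scal; simpl; unfold mult; simpl; field; apply INR_fact_neq_0. }
assert (E : PS_derive (a k) n =
            PS_plus (PS_scal (INR k) (a (pred k))) (PS_scal (INR k) (a (S k))) n).
{ apply (is_pseries_coef_unique _ _
          (fun t => INR k * tan t ^ pred k + INR k * tan t ^ S k)).
  - apply (is_pseries_is_derive _ (fun t => tan t ^ k)); [apply Ha|].
    exists (mkposreal 1 Rlt_0_1); intros t Ht.
    change (Rabs (t - 0) < 1) in Ht; rewrite Rminus_0_r in Ht.
    now apply is_derive_tan_pow.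
  - generalize (filter_and _ _ (Ha (pred k)) (Ha (S k))).
    apply filter_imp; intros t [H1 H2].
    exact (is_pseries_plus _ _ _ _ _
             (is_pseries_scal (INR k) _ _ _ (Rmult_comm _ _) H1)
             (is_pseries_scal (INR k) _ _ _ (Rmult_comm _ _) H2)). }
change (INR (S n) * (INR (fact k) * T (S n) k / INR (fact (S n))) =
        INR k * (INR (fact (pred k)) * T n (pred k) / INR (fact n))
        + INR k * (INR (fact (S k)) * T n (S k) / INR (fact n))) in E.
assert (Hn := INR_fact_neq_0 n).
assert (HS : INR (S n) <> 0) by (apply not_0_INR; lia).
replace (fact (S n)) with (S n * fact n)%nat in E by reflexivity.
rewrite mult_INR in E.
apply (Rmult_eq_reg_r (/ INR (fact n))); [|now apply Rinv_neq_0_compat].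
etransitivity; [|etransitivity; [exact E|]]; field; auto.
Qed.

Lemma tangent_init (T : nat -> nat -> R) (k : nat) :
  higher_tangent_numbers T ->
  INR (fact k) * T 0%nat k = if Nat.eqb k 0 then 1 else 0.
Proof.
intros [H0 HT]; destruct k as [|k].
- specialize (HT 0%nat); apply locally_singleton, is_pseries_unique in HT.
  rewrite PSeries_0 in HT; simpl in HT |- *; lra.
- rewrite H0 by lia; simpl; ring.
Qed.

(** * Binomial coefficients with an integer lower index *)

Lemma binom_out (m : nat) (j : Z) :
  (j < 0 \/ Z.of_nat m < j)%Z -> binom m j = 0.
Proof.
intros H; unfold binom.
destruct (Z.leb_spec 0 j), (Z.leb_spec j (Z.of_nat m)); simpl; auto; lia.
Qed.

Lemma binom_in (m i : nat) :
  (i <= m)%nat -> binom m (Z.of_nat i) = Binomial.C m i.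
Proof.
intros H; unfold binom.
destruct (Z.leb_spec 0 (Z.of_nat i)), (Z.leb_spec (Z.of_nat i) (Z.of_nat m));
  simpl; try lia.
now rewrite Nat2Z.id.
Qed.

Lemma binom_0_r (m : nat) : binom m 0 = 1.
Proof. change 0%Z with (Z.of_nat 0); rewrite binom_in by lia; apply C_n_0. Qed.

Lemma binom_pascal (m : nat) (j : Z) :
  binom (S m) (j + 1) = binom m j + binom m (j + 1).
Proof.
destruct (Z_lt_le_dec j (-1)); [rewrite !binom_out by lia; ring|].
destruct (Z.eq_dec j (-1)) as [->|].
{ change (-1 + 1)%Z with 0%Z; rewrite !binom_0_r, binom_out by lia; ring. }
destruct (Z_lt_le_dec (Z.of_nat m) j); [rewrite !binom_out by lia; ring|].
destruct (Z_of_nat_complete j) as [i ->]; [lia|].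
replace (Z.of_nat i + 1)%Z with (Z.of_nat (S i)) by lia.
destruct (Nat.eq_dec i m) as [->|].
- rewrite (binom_out m (Z.of_nat (S m))), !binom_in by lia.
  rewrite !C_n_n; ring.
- rewrite !binom_in by lia; symmetry; apply pascal; lia.
Qed.

Lemma binom_absorb (m : nat) (j : Z) :
  IZR (j + 1) * binom (S m) (j + 1) = INR (S m) * binom m j.
Proof.
destruct (Z.eq_dec j (-1)) as [->|].
{ rewrite (binom_out m) by lia; simpl IZR; ring. }
destruct (Z_lt_le_dec j 0); [rewrite !binom_out by lia; ring|].
destruct (Z_lt_le_dec (Z.of_nat m) j); [rewrite !binom_out by lia; ring|].
destruct (Z_of_nat_complete j) as [i ->]; [lia|].
replace (Z.of_nat i + 1)%Z with (Z.of_nat (S i)) by lia.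
rewrite !binom_in by lia; rewrite <- INR_IZR_INZ; unfold Binomial.C.
replace (fact (S m)) with (S m * fact m)%nat by reflexivity.
replace (fact (S i)) with (S i * fact i)%nat by reflexivity.
rewrite !mult_INR; simpl Nat.sub; field.
repeat split; try apply INR_fact_neq_0; apply not_0_INR; lia.
Qed.

(** * Alternating binomial sums of powers *)

(** Up to the sign [(-1) ^ a], the [a]-th finite difference of [x ^ n] at 0,
    that is [a!] times a Stirling number of the second kind. *)
Definition altpow (n a : nat) : R :=
  sum_f_R0 (fun b => (-1) ^ b * binom a (Z.of_nat b) * INR b ^ n) a.

Lemma altpow_shift (n a : nat) :
  sum_f_R0 (fun b => (-1) ^ b * binom a (Z.of_nat b) * INR (S b) ^ n) a =
  altpow n a - altpow n (S a).
Proof.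
assert (E : altpow n a =
  sum_f_R0 (fun b => (-1) ^ b * binom a (Z.of_nat b) * INR b ^ n) (S a)).
{ rewrite tech5, (binom_out a (Z.of_nat (S a))) by lia.
  unfold altpow; ring. }
rewrite E; unfold altpow; rewrite !(decomp_sum _ (S a)) by lia; simpl pred.
change (Z.of_nat 0) with 0%Z; rewrite !binom_0_r.
match goal with |- ?X = ?c + ?Y - (?c + ?Z) =>
  enough (H : X + Z = Y) by lra end.
rewrite <- sum_plus; apply sum_eq; intros b _.
replace (Z.of_nat (S b)) with (Z.of_nat b + 1)%Z by lia.
rewrite binom_pascal; simpl pow; ring.
Qed.

Lemma altpow_rec (n a : nat) :
  altpow (S n) (S a) = INR (S a) * (altpow n (S a) - altpow n a).
Proof.
replace (altpow n (S a) - altpow n a) with (- (altpow n a - altpow n (S a))) by ring.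
rewrite <- altpow_shift, Ropp_mult_distr_r_reverse, Ropp_mult_distr_l, scal_sum.
unfold altpow; rewrite decomp_sum by lia; simpl pred.
replace (INR 0 ^ S n) with 0 by (simpl; ring).
rewrite Rmult_0_r, Rplus_0_l; apply sum_eq; intros b _.
assert (H := binom_absorb a (Z.of_nat b)).
replace (Z.of_nat b + 1)%Z with (Z.of_nat (S b)) in H by lia.
rewrite <- INR_IZR_INZ in H; rewrite <- !tech_pow_Rmult.
transitivity (- ((-1) ^ b * INR (S b) ^ n) *
  (INR (S b) * binom (S a) (Z.of_nat (S b)))); [ring|rewrite H; ring].
Qed.

Lemma altpow_0_r (n : nat) : altpow (S n) 0 = 0.
Proof. unfold altpow; simpl; ring. Qed.

Lemma altpow_0_0 : altpow 0 0 = 1.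
Proof. unfold altpow; simpl; rewrite binom_0_r; ring. Qed.

Lemma altpow_out (n a : nat) : (n < a)%nat -> altpow n a = 0.
Proof.
revert a; induction n as [|n IH]; intros [|a] Ha; try lia.
- (* For [n = 0] the shifted sum is the sum itself. *)
  assert (H := altpow_shift 0 a).
  change (altpow 0 a = altpow 0 a - altpow 0 (S a)) in H; lra.
- rewrite altpow_rec, !IH by lia; ring.
Qed.

(** * The double sum and its recurrence *)

(** The coefficient of [x ^ a] in [(x / (1 - x)) ^ k].  At [a = 0] it is not
    given by [binom (a - 1) (k - 1)] with truncated subtraction. *)
Definition geom_coef (a k : nat) : R :=
  match a with
  | O => if Nat.eqb k 0 then 1 else 0
  | S a' => binom a' (Z.of_nat k - 1)
  end.

Lemma geom_coef_out (a k : nat) : (a < k)%nat -> geom_coef a k = 0.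
Proof.
intros H; destruct a as [|a]; simpl.
- now destruct k; [lia|].
- apply binom_out; lia.
Qed.

(** With [y = x / (1 - x)], [x * y' = y + y ^ 2] and [y' = (1 + y) ^ 2], hence
    [2 x (y ^ k)' - (y ^ k)' = k (y ^ (k + 1) - y ^ (k - 1))]; this is the
    equality of the coefficients of [x ^ a]. *)
Lemma geom_coef_rec (a k : nat) :
  2 * INR a * geom_coef a k - INR (S a) * geom_coef (S a) k =
  INR k * (geom_coef a (S k) - geom_coef a (pred k)).
Proof.
destruct k as [|k].
{ replace (geom_coef (S a) 0) with 0
    by (unfold geom_coef; rewrite binom_out by lia; reflexivity).
  destruct a as [|a]; [simpl; ring|].
  replace (geom_coef (S a) 0) with 0
    by (unfold geom_coef; rewrite binom_out by lia; reflexivity).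
  simpl (INR 0); ring. }
destruct a as [|a]; unfold geom_coef; simpl pred.
{ destruct k as [|k].
  - change (Z.of_nat 1 - 1)%Z with 0%Z; rewrite binom_0_r; simpl; ring.
  - rewrite binom_out by lia; simpl Nat.eqb; simpl (INR 0); ring. }
replace (Z.of_nat (S k) - 1)%Z with (Z.of_nat k) by lia.
replace (Z.of_nat (S (S k)) - 1)%Z with (Z.of_nat k + 1)%Z by lia.
set (j := Z.of_nat k).
assert (H1 := binom_absorb a j); assert (H2 := binom_absorb (S a) j).
assert (P0 := binom_pascal a j); assert (P1 := binom_pascal (S a) j).
assert (P2 := binom_pascal a (j - 1)).
replace (j - 1 + 1)%Z with j in P2 by lia.
replace (INR (S k)) with (IZR (j + 1))
  by (unfold j; rewrite INR_IZR_INZ; f_equal; lia).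
rewrite Rmult_assoc, <- H1, <- H2, P1, P0, P2; ring.
Qed.

Definition tansum (n k : nat) : R :=
  sum_f_R0 (fun a => geom_coef a k * (2 ^ n / 2 ^ a * altpow n a)) n.

(** Summation by parts: the shift of [alpha] in [altpow_rec] moves to
    [geom_coef]. *)
Lemma tansum_rec (n k : nat) :
  tansum (S n) k = INR k * (tansum n (S k) - tansum n (pred k)).
Proof.
set (v := fun a => 2 ^ n / 2 ^ a * altpow n a).
set (p := fun a => 2 * INR a * geom_coef a k * v a).
set (q := fun a => INR (S a) * geom_coef (S a) k * v a).
assert (Hv : forall a,
  2 ^ S n / 2 ^ S a * altpow (S n) (S a) = INR (S a) * (2 * v (S a) - v a)).
{ intros a; rewrite altpow_rec; unfold v; simpl pow; field.
  apply pow_nonzero; lra. }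
(* The sum of [p] is taken up to [S n], then reindexed: its terms at the two
   ends vanish. *)
assert (Hp : sum_f_R0 p n = sum_f_R0 (fun a => p (S a)) n).
{ transitivity (sum_f_R0 p (S n)).
  - rewrite tech5; unfold p at 3, v; rewrite altpow_out by lia; ring.
  - rewrite decomp_sum by lia; unfold p at 1; simpl (INR 0); simpl pred; ring. }
transitivity (sum_f_R0 (fun a => p (S a)) n - sum_f_R0 q n).
- unfold tansum; rewrite decomp_sum by lia; simpl pred.
  rewrite altpow_0_r, !Rmult_0_r, Rplus_0_l, <- minus_sum.
  apply sum_eq; intros a _; rewrite Hv; unfold p, q; ring.
- rewrite <- Hp; unfold tansum; rewrite <- !minus_sum, scal_sum.
  apply sum_eq; intros a _; unfold p, q; fold (v a).
  transitivity ((2 * INR a * geom_coef a k - INR (S a) * geom_coef (S a) k) * v a);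
    [ring|rewrite geom_coef_rec; ring].
Qed.

Lemma tansum_init (k : nat) : tansum 0 k = if Nat.eqb k 0 then 1 else 0.
Proof.
unfold tansum; simpl sum_f_R0; rewrite altpow_0_0; simpl; field.
Qed.

Lemma sum_n_m_from_0 (f : nat -> R) (k n : nat) :
  (forall a, (a < k)%nat -> f a = 0) -> sum_n_m f k n = sum_f_R0 f n.
Proof.
intros Hf; rewrite <- sum_n_Reals; unfold sum_n.
assert (H0 : forall m, (m < k)%nat -> sum_n_m f 0 m = 0).
{ intros m Hm.
  rewrite (sum_n_m_ext_loc _ (fun _ => zero)) by (intros; apply Hf; lia).
  apply (sum_n_m_const_zero (G := R_AbelianMonoid)). }
destruct (Nat.lt_ge_cases n k) as [Hn|Hn].
- now rewrite H0, (sum_n_m_zero f k n).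
- destruct k as [|k]; [easy|].
  rewrite (sum_n_m_Chasles f 0 k n) by lia.
  rewrite H0 by lia; symmetry; apply Rplus_0_l.
Qed.

(** For [n >= 1] the terms [alpha = 0] and [beta = 0] added in [tansum]
    vanish, because [0 ^ n = 0]. *)
Lemma tansum_double_sum (n k : nat) :
  (1 <= n)%nat ->
  2 ^ n * sum_n_m (fun alpha : nat =>
           sum_n_m (fun beta : nat =>
             (-1) ^ beta * binom (alpha - 1) (Z.of_nat k - 1)
             * binom alpha (Z.of_nat beta) * (INR beta ^ n / 2 ^ alpha))
           1 alpha) k n
  = tansum n k.
Proof.
intros Hn; destruct n as [|n]; [lia|clear Hn].
rewrite (sum_n_m_ext _
  (fun a => geom_coef a k * (/ 2 ^ a * altpow (S n) a))).
- rewrite sum_n_m_from_0 by (intros a Ha; rewrite geom_coef_out by easy; ring).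
  unfold tansum; rewrite scal_sum; apply sum_eq; intros a _.
  unfold Rdiv; ring.
- intros [|a].
  { rewrite altpow_0_r, sum_n_m_zero by lia; unfold zero; simpl; ring. }
  rewrite sum_n_m_from_0.
  + unfold altpow; rewrite <- Rmult_assoc, scal_sum; apply sum_eq; intros b _.
    simpl Nat.sub; rewrite Nat.sub_0_r; simpl geom_coef; unfold Rdiv; ring.
  + intros b Hb; replace b with 0%nat by lia; simpl (INR 0).
    rewrite pow_i by lia; unfold Rdiv; ring.
Qed.

(** * Powers of the imaginary unit *)

Lemma Cpowz_succ (z : C) (m : Z) :
  z <> RtoC 0 -> Cpowz z (m + 1) = Cmult z (Cpowz z m).
Proof.
intros Hz; destruct m as [|p|p].
- simpl; ring.
- replace (Zpos p + 1)%Z with (Zpos (Pos.succ p)) by lia; unfold Cpowz.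
  now rewrite Pos2Nat.inj_succ, Cpow_S.
- destruct (Pos.eq_dec p 1) as [->|Hp].
  + simpl; field; exact Hz.
  + replace (Zneg p + 1)%Z with (Zneg (Pos.pred p)) by lia; unfold Cpowz.
    rewrite <- (Pos.succ_pred p Hp) at 2.
    rewrite Pos2Nat.inj_succ, Cpow_S.
    field; split; [now apply Cpow_nz|exact Hz].
Qed.

Lemma Ci_neq_0 : Ci <> RtoC 0.
Proof. intros H; injection H; lra. Qed.

Lemma Ci_sqr : Cmult Ci Ci = RtoC (-1).
Proof. unfold Ci, Cmult, RtoC; simpl; f_equal; ring. Qed.

(** The exponents [n - (k - 1)] and [n - (k + 1)] differ by 2, and
    [i ^ 2 = -1] reconciles the sum in [tangent_rec] with the difference in
    [tansum_rec]. *)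
Lemma tangent_tansum (T : nat -> nat -> R) (n k : nat) :
  higher_tangent_numbers T ->
  RtoC (INR (fact k) * T n k) =
  Cmult (Cpowz Ci (Z.of_nat n - Z.of_nat k)) (RtoC ((-1) ^ n * tansum n k)).
Proof.
intros HT; revert k; induction n as [|n IH]; intros k.
- rewrite tangent_init, tansum_init by easy; destruct k as [|k].
  + simpl; rewrite Rmult_1_l; ring.
  + simpl Nat.eqb; cbv iota; rewrite Rmult_0_r; ring.
- rewrite tangent_rec, tansum_rec by easy; destruct k as [|k].
  { simpl (INR 0); rewrite !Rmult_0_l, Rmult_0_r; ring. }
  rewrite RtoC_mult, RtoC_plus, !IH; simpl pred.
  set (z := (Z.of_nat n - Z.of_nat (S (S k)))%Z).
  replace (Z.of_nat n - Z.of_nat k)%Z with (z + 1 + 1)%Z by lia.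
  replace (Z.of_nat (S n) - Z.of_nat (S k))%Z with (z + 1 + 1)%Z by lia.
  rewrite !(Cpowz_succ Ci) by exact Ci_neq_0.
  rewrite !Cmult_assoc, Ci_sqr.
  simpl pow; unfold Rminus.
  rewrite !RtoC_mult, !RtoC_plus, !RtoC_opp; ring.
Qed.

Theorem proposition8 :
  forall T : nat -> nat -> R, higher_tangent_numbers T ->
  forall n k : nat, (1 <= n)%nat ->
  RtoC (T n k) =
  Cmult (Cpowz Ci (Z.of_nat n - Z.of_nat k)%Z)
   (RtoC ((-1) ^ n * (2 ^ n / INR (fact k)) *
         sum_n_m (fun alpha : nat =>
           sum_n_m (fun beta : nat =>
             (-1) ^ beta * binom (alpha - 1) (Z.of_nat k - 1)
             * binom alpha (Z.of_nat beta) * (INR beta ^ n / 2 ^ alpha))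
           1 alpha) k n)).
Proof.
intros T HT n k Hn.
assert (H := tangent_tansum T n k HT).
rewrite <- tansum_double_sum in H by exact Hn.
set (s := sum_n_m _ k n) in *; clearbody s.
assert (Hk := INR_fact_neq_0 k).
replace (T n k) with (INR (fact k) * T n k * / INR (fact k)) by now field.
rewrite RtoC_mult, H, <- Cmult_assoc, <- RtoC_mult.
do 2 f_equal; field; exact Hk.
Qed.
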